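(* Let $Q$ be a star network with three arcs of lengths $a_1\ge a_2\ge a_3>0$, $a_1+a_2+a_3=1$, meeting at a center node, and consider the game $\Gamma'_1(Q)$ with one booby trap. If $a_1<1/2$, then the value of the game is $a_1(1-a_1)$. The attacker's partition strategy is optimal. For the defender, it is optimal to place the booby trap on arc $j$ at distance $x$ from the center, where the location is chosen according to the cumulative distribution functions $$F_j(x)=\min\left\{a_j,\ \frac{(1-a_j)x}{a_j}\right\},\qquad 0\le x\le a_j,\quad j=1,2,3,$$ that is, $F_j(x)$ is the probability that the booby trap lies on arc $j$ at distance at most $x$ from the center.
   Context: The game $\Gamma'_1(Q)$ on a network $Q$ with length measure $\lambda$, $\lambda(Q)=1$: the defender chooses a point of $Q$ (the location of the single booby trap) and the attacker chooses a connected subset $S\subseteq Q$, without knowing each other's choice. The payoff to the attacker is $\lambda(S)$ if the booby trap is not in $S$, and $0$ otherwise; the attacker maximizes and the defender minimizes the expected payoff. Mixed strategies are random choices of pure strategies (such that the payoff against each opposing pure strategy is measurable). The game has value $V$ if for every $\varepsilon>0$ the attacker has a mixed strategy with expected payoff at least $V-\varepsilon$ against every pure strategy of the defender, and the defender has a mixed strategy with expected payoff at most $V+\varepsilon$ against every pure strategy of the attacker. A mixed strategy of the defender (attacker) is optimal if it guarantees expected payoff at most (at least) $V$ against every opposing pure strategy. Partition strategy of the attacker: when $a_1<1/2$, the center node is the centroid of the star (the unique point minimizing the maximum length of a component left after its removal), and removing it leaves $n=3$ components of lengths $a_1,a_2,a_3$. For a nonempty $S\subseteq\{1,2,3\}$,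 put $D(S)=\sum_{j\notin S}\frac1{a_j}+\frac{1}{\sum_{j\in S}a_j}$ and consider the mixed strategy that takes the whole of component $i$ (without the center) with probability $\frac{1/a_i}{D(S)}$ for each $i\notin S$, and takes all components in $S$ together with the center with probability $\frac{1/\sum_{j\in S}a_j}{D(S)}$. This strategy guarantees expected payoff $W(S)=\frac{3-|S|}{D(S)}$. The partition strategy is the strategy of this form for a set $S$ maximizing $W(S)$. *)

(* Defs.v *)
(* MathComp / MathComp-Analysis. *)
From HB Require Import structures.
From mathcomp Require Import all_boot all_order all_algebra.
From mathcomp Require Import all_classical all_reals all_analysis.
From mathcomp Require Import measurable_realfun.
Set Implicit Arguments.
Unset Strict Implicit.
Unset Printing Implicit Defensive.
Import Order.TTheory GRing.Theory Num.Theory.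
Import numFieldNormedType.Exports.
Local Open Scope classical_set_scope.
Local Open Scope ring_scope.

Section Game.
Variables (R : realType) (M : topologicalType).
(* The network is the subspace Q of M; len is its length measure. *)
Variables (Q : set M) (len : set M -> \bar R).

(* The empty set counts as connected; choosing it yields payoff 0. *)
Definition attack (S : set M) : Prop := S `<=` Q /\ connected S.

Definition payoff (q : M) (S : set M) : \bar R :=
  if q \in S then 0%E else len S.

(* A mixed strategy is a random pure strategy defined on an arbitrary
   probability space. *)
Record defender_strategy := DefenderStrategy {
  trap_disp : measure_display;
  trap_space : measurableType trap_disp;
  trap_prob : probability trap_space R;
  trap : trap_space -> M;
  trap_in : forall w, Q (trap w);
  trap_measurable : forall S, attack S ->
    measurable_fun setT (fun w => payoff (trap w) S)
}.

Record attacker_strategy := AttackerStrategy {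
  raid_disp : measure_display;
  raid_space : measurableType raid_disp;
  raid_prob : probability raid_space R;
  raid : raid_space -> set M;
  raid_attack : forall w, attack (raid w);
  raid_measurable : forall q, Q q ->
    measurable_fun setT (fun w => payoff q (raid w))
}.

Definition defender_payoff (s : defender_strategy) (S : set M) : \bar R :=
  (\int[trap_prob s]_w payoff (trap w) S)%E.

Definition attacker_payoff (s : attacker_strategy) (q : M) : \bar R :=
  (\int[raid_prob s]_w payoff q (raid w))%E.

Definition defender_guarantees (s : defender_strategy) (v : R) : Prop :=
  forall S, attack S -> (defender_payoff s S <= v%:E)%E.

Definition attacker_guarantees (s : attacker_strategy) (v : R) : Prop :=
  forall q, Q q -> (v%:E <= attacker_payoff s q)%E.

Definition has_value (V : R) : Prop :=
  forall e : R, 0 < e ->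
    (exists s, attacker_guarantees s (V - e)) /\
    (exists s, defender_guarantees s (V + e)).

Definition defender_optimal (s : defender_strategy) : Prop :=
  exists2 V, has_value V & defender_guarantees s V.

Definition attacker_optimal (s : attacker_strategy) : Prop :=
  exists2 V, has_value V & attacker_guarantees s V.

End Game.

Section Star.
Variables (R : realType) (n : nat) (a : 'I_n -> R).

(* The star is embedded in R^n with arc j along the j-th coordinate axis and
   the center at the origin. *)
Definition arc_point (j : 'I_n) (t : R) : 'rV[R]_n := t *: delta_mx 0 j.

Definition star : set 'rV[R]_n :=
  \bigcup_(j : 'I_n) (arc_point j @` `[0, a j]).

(* The center lies on every arc but is Lebesgue-null on each of them. *)
Definition star_length (S : set 'rV[R]_n) : \bar R :=
  (\sum_(j < n) lebesgue_measure (`[0%R, a j] `&` arc_point j @^-1` S))%E.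

Definition star_component (j : 'I_n) : set 'rV[R]_n :=
  arc_point j @` `]0, a j].

Definition star_block (S : {set 'I_n}) : set 'rV[R]_n :=
  [set 0] `|` \bigcup_(j in [set` S]) star_component j.

Definition partition_D (S : {set 'I_n}) : R :=
  \sum_(j | j \notin S) (a j)^-1 + (\sum_(j in S) a j)^-1.

Definition partition_W (S : {set 'I_n}) : R :=
  (n - #|S|)%:R / partition_D S.

Definition partition_choice (S : {set 'I_n}) : Prop :=
  S != finset.set0 /\
  forall S' : {set 'I_n}, S' != finset.set0 -> partition_W S' <= partition_W S.

Definition partition_law (S : {set 'I_n})
    (s : attacker_strategy star star_length) : Prop :=
  (forall i, i \notin S ->
     let E := [set w | raid (a := s) w = star_component i] in
     measurable E /\
     raid_prob s E = ((a i)^-1 / partition_D S)%:E) /\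
  (let E := [set w | raid (a := s) w = star_block S] in
   measurable E /\
   raid_prob s E = ((\sum_(j in S) a j)^-1 / partition_D S)%:E).

Definition trap_cdf (j : 'I_n) (x : R) : R :=
  Num.min (a j) ((1 - a j) * x / a j).

(* Points of arc j at distance at most x from the center, center included. *)
Definition trap_law (s : defender_strategy star star_length) : Prop :=
  forall (j : 'I_n) (x : R), 0 <= x <= a j ->
    let E := [set w | (arc_point j @` `[0, x]) (trap (d := s) w)] in
    measurable E /\ trap_prob s E = (trap_cdf j x)%:E.

End Star.

(* Main.v *)
(** A raid of total length [X] that meets the trap with probability [K] earns
    [X * (1 - K)].  The clipped-linear cdf [F_j] lies above the line of slope
    [(1 - a1) / a1] until it saturates at [a_j^2 / (1 - a_j)], and a saturated
    arc [j] falls short of that line by at most [1 - 2 a1].  If at most one arc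
    is saturated, AM-GM therefore bounds the payoff by [a1 * (1 - a1)]; two
    saturated arcs leave a concave function of the third length, and three
    leave nothing.

    A connected subset of the star is understood through the signed distances
    "distance to the center, negative off arc [j]": they are continuous, hence
    map it to intervals, so it meets each arc in an interval and lies in a
    single arc if it avoids the center.

    On the attacker's side, each piece of the partition is taken with
    probability inversely proportional to its length, so every piece missed by
    the trap contributes the same amount to the payoff, and exactly one piece
    contains the trap. *)
Require Import Defs.
From HB Require Import structures.
From mathcomp Require Import all_boot all_order all_algebra.
From mathcomp Require Import all_classical all_reals all_analysis.
From mathcomp Require Import measurable_realfun lra ring.
Import Order.TTheory GRing.Theory Num.Theory.
Import numFieldNormedType.Exports.
Set Implicit Arguments.
Unset Strict Implicit.
Unset Printing Implicit Defensive.
Local Open Scope classical_set_scope.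
Local Open Scope ring_scope.

(** * The payoff inequality *)

Section Inequalities.
Variable R : realFieldType.

(* The function [trap_cdf], with the arc length as a parameter. *)
Definition clipped (a x : R) : R := Num.min a ((1 - a) * x / a).

(** The two branches of the minimum cross at [a ^+ 2 / (1 - a)], the saturation point of the arc. *)
Lemma clipped_low (a x : R) : 0 < a -> a < 2^-1 -> x <= a ^+ 2 / (1 - a) ->
  clipped a x = (1 - a) / a * x.
Proof.
move=> a0 a1; rewrite ler_pdivlMr ?subr_gt0; last lra.
move=> h; rewrite /clipped mulrAC; apply/min_idPr.
by rewrite mulrAC ler_pdivrMr //; nra.
Qed.

Lemma clipped_high (a x : R) : 0 < a -> a < 2^-1 -> a ^+ 2 / (1 - a) <= x ->
  clipped a x = a.
Proof.
move=> a0 a1; rewrite ler_pdivrMr ?subr_gt0; last lra.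
move=> h; rewrite /clipped; apply/min_idPl.
by rewrite ler_pdivlMr //; nra.
Qed.

Lemma slope_ge (a b : R) : 0 < b -> b <= a -> (1 - a) / a <= (1 - b) / b.
Proof.
move=> b0 ab; rewrite ler_pdivrMr ?(lt_le_trans b0) //.
by rewrite mulrAC ler_pdivlMr //; nra.
Qed.

(** The slope [(1 - a) / a] decreases in [a], so the longest arc supplies one line that serves for
    all arcs. *)
Lemma clipped_ge_slope (a b x : R) : 0 < a -> a <= b -> b < 2^-1 ->
  0 <= x -> x <= a ^+ 2 / (1 - a) -> (1 - b) / b * x <= clipped a x.
Proof.
move=> a0 ab b1 x0 xa; rewrite clipped_low //; last lra.
by rewrite ler_wpM2r // slope_ge.
Qed.

(** For [x <= a] the line exceeds the saturated value [a] by at most [a * (1 - 2 * b) / b], which is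
    at most [1 - 2 * b] as [a <= b]. *)
Lemma clipped_ge_slope_saturated (a b x : R) : 0 < a -> a <= b -> b < 2^-1 ->
  a ^+ 2 / (1 - a) <= x -> x <= a ->
  (1 - b) / b * x + (2 * b - 1) <= clipped a x.
Proof.
move=> a0 ab b1 xa x1; rewrite (@clipped_high a) //; last lra.
have b0 : 0 < b by lra.
rewrite -(ler_pM2r b0) mulrDl mulrAC divfK ?gt_eqF //; nra.
Qed.

(** The hypothesis bounds the left side by [(1 - b) / b * X * (2 * b - X)], a parabola with its
    maximum at [X = b]. *)
Lemma amgm_slope (b X K : R) : 0 < b -> b < 2^-1 -> 0 <= X ->
  (1 - b) / b * X + (2 * b - 1) <= K -> X * (1 - K) <= b * (1 - b).
Proof.
move=> b0 b1 X0 h.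
have h' : (1 - b) * X + (2 * b - 1) * b <= K * b.
  move: h; rewrite -(ler_pM2r b0) mulrDl mulrAC divfK ?gt_eqF //.
rewrite -(ler_pM2r b0).
have : 0 <= (1 - b) * (X - b) ^+ 2 by rewrite mulr_ge0 ?sqr_ge0; lra.
have : X * ((1 - b) * X + (2 * b - 1) * b) <= X * (K * b) by rewrite ler_wpM2l.
lra.
Qed.

Lemma two_saturated_le (a b c x y z : R) : 0 < a -> a < 2^-1 -> a + b + c = 1 ->
  0 <= y <= b -> 0 <= z <= c -> 0 <= x -> x <= a ^+ 2 / (1 - a) ->
  (x + y + z) * (1 - (clipped a x + b + c)) <= a * (1 - a).
Proof.
move=> a0 a1 abc yb zc x0 xa; rewrite clipped_low //.
have := xa; rewrite ler_pdivlMr ?subr_gt0; last lra.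
(* [P / a] is the probability of escaping the trap. With [y + z <= 1 - a], what remains is
   [(x + (1 - a)) * P], which decreases in [x >= 0] since [a < 1 - a]. *)
move=> xa'; pose P := a * a - (1 - a) * x.
have -> : 1 - ((1 - a) / a * x + b + c) = P / a.
  have -> : c = 1 - a - b by lra.
  by rewrite /P; field; exact: lt0r_neq0.
rewrite mulrA ler_pdivrMr //.
apply: (@le_trans _ _ ((x + (1 - a)) * P)); last by rewrite /P; nra.
by rewrite ler_wpM2r //; [rewrite /P; nra|lra].
Qed.

Lemma ler_mul_compl (a b : R) : 0 < a -> a <= b -> b < 2^-1 ->
  a * (1 - a) <= b * (1 - b).
Proof. nra. Qed.

Lemma raid_center_le (a1 a2 a3 x1 x2 x3 : R) :
  a2 <= a1 -> a3 <= a2 -> 0 < a3 -> a1 + a2 + a3 = 1 -> a1 < 2^-1 ->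
  0 <= x1 <= a1 -> 0 <= x2 <= a2 -> 0 <= x3 <= a3 ->
  (x1 + x2 + x3) * (1 - (clipped a1 x1 + clipped a2 x2 + clipped a3 x3)) <=
    a1 * (1 - a1).
Proof.
move=> h12 h23 h3 hs h1 hx1 hx2 hx3.
have [x10 x1a] := andP hx1; have [x20 x2a] := andP hx2.
have [x30 x3a] := andP hx3.
have a20 : 0 < a2 by lra.
have a10 : 0 < a1 by lra.
have a2h : a2 < 2^-1 by lra.
have a3h : a3 < 2^-1 by lra.
have [l1|/ltW l1] := leP x1 (a1 ^+ 2 / (1 - a1));
have [l2|/ltW l2] := leP x2 (a2 ^+ 2 / (1 - a2));
have [l3|/ltW l3] := leP x3 (a3 ^+ 2 / (1 - a3)).
(* With no saturated arc the lower bound on the sum holds without the term [2 * a1 - 1], which is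
   negative and may be added. *)
- have k1 := @clipped_ge_slope a1 a1 x1 a10 (lexx _) h1 x10 l1.
  have k2 := @clipped_ge_slope a2 a1 x2 a20 h12 h1 x20 l2.
  have k3 := @clipped_ge_slope a3 a1 x3 h3 (le_trans h23 h12) h1 x30 l3.
  apply: amgm_slope; rewrite ?mulrDr //; lra.
- have k1 := @clipped_ge_slope a1 a1 x1 a10 (lexx _) h1 x10 l1.
  have k2 := @clipped_ge_slope a2 a1 x2 a20 h12 h1 x20 l2.
  have k3 := @clipped_ge_slope_saturated a3 a1 x3 h3 (le_trans h23 h12) h1 l3 x3a.
  apply: amgm_slope; rewrite ?mulrDr //; lra.
- have k1 := @clipped_ge_slope a1 a1 x1 a10 (lexx _) h1 x10 l1.
  have k2 := @clipped_ge_slope_saturated a2 a1 x2 a20 h12 h1 l2 x2a.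
  have k3 := @clipped_ge_slope a3 a1 x3 h3 (le_trans h23 h12) h1 x30 l3.
  apply: amgm_slope; rewrite ?mulrDr //; lra.
(* Two saturated arcs: the unsaturated one takes the role of [a] in [two_saturated_le], and
   monotonicity of [t * (1 - t)] below [2^-1] passes from it to [a1] when it is another arc. *)
- rewrite (@clipped_high a2) // (@clipped_high a3) //.
  exact: two_saturated_le.
- have k1 := @clipped_ge_slope_saturated a1 a1 x1 a10 (lexx _) h1 l1 x1a.
  have k2 := @clipped_ge_slope a2 a1 x2 a20 h12 h1 x20 l2.
  have k3 := @clipped_ge_slope a3 a1 x3 h3 (le_trans h23 h12) h1 x30 l3.
  apply: amgm_slope; rewrite ?mulrDr //; lra.
- rewrite (@clipped_high a1) // (@clipped_high a3) // (addrC x1) (addrC a1).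
  apply: le_trans (ler_mul_compl a20 h12 h1).
  apply: two_saturated_le => //; lra.
- rewrite (@clipped_high a1) // (@clipped_high a2) //.
  apply: le_trans (ler_mul_compl h3 (le_trans h23 h12) h1).
  rewrite (addrC _ x3) (addrC _ (clipped a3 x3)) !addrA.
  apply: two_saturated_le => //; lra.
- rewrite (@clipped_high a1) // (@clipped_high a2) // (@clipped_high a3) //.
  rewrite hs subrr mulr0.
  by rewrite mulr_ge0; lra.
Qed.

(** The cases are the positions of [u] and [v] relative to the saturation point of the arc. *)
Lemma raid_arc_le (a b u v : R) : 0 < a -> a <= b -> b < 2^-1 ->
  0 <= u -> u <= v -> v <= a ->
  (v - u) * (1 - (clipped a v - clipped a u)) <= b * (1 - b).
Proof.
move=> a0 ab b1 u0 uv va.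
have ah : a < 2^-1 by lra.
apply: le_trans (ler_mul_compl a0 ab b1).
have [l1|l1] := leP v (a ^+ 2 / (1 - a)).
  rewrite !clipped_low //; last exact: le_trans l1.
  rewrite -mulrBr; apply: amgm_slope => //; lra.
have [l2|l2] := leP u (a ^+ 2 / (1 - a)).
  rewrite (@clipped_low a u) // (@clipped_high a v a0 ah (ltW l1)).
  (* [P] factors as [(1 - a) * (a + u)], so [(a - u) * P] is [(1 - a) * (a ^+ 2 - u ^+ 2)]. *)
  pose P := a - a * a + (1 - a) * u.
  have -> : 1 - (a - (1 - a) / a * u) = P / a.
    by rewrite /P; field; exact: lt0r_neq0.
  rewrite mulrA ler_pdivrMr //.
  apply: (@le_trans _ _ ((a - u) * P)); last by rewrite /P; nra.
  by rewrite ler_wpM2r //; [rewrite /P; nra|lra].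
rewrite (@clipped_high a u a0 ah (ltW l2)) (@clipped_high a v a0 ah (ltW l1)).
rewrite subrr subr0 mulr1.
(* Beyond saturation the trap is never met, but the raid fits into the remaining length
   [a * (1 - 2 * a) / (1 - a)], and [1 - 2 * a <= (1 - a) ^+ 2]. *)
apply: (@le_trans _ _ (a - a ^+ 2 / (1 - a))); first by rewrite lerB // ltW.
rewrite lerBlDr -lerBlDl ler_pdivlMr ?subr_gt0; nra.
Qed.
End Inequalities.

(** * Connected subsets of a star *)

Section StarTopology.
Context {R : realType} {n : nat}.
Variable a : 'I_n -> R.
Implicit Types (S : set 'rV[R]_n) (p : 'rV[R]_n) (j k : 'I_n).

(* Equals the distance to the center on arc [j] and minus it on other arcs. *)
Definition signed_dist j p : R := p 0 j + p 0 j - \sum_k p 0 k.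

Lemma signed_dist_arc j k (t : R) :
  signed_dist j (arc_point k t) = if k == j then t else - t.
Proof.
rewrite /signed_dist /arc_point; under eq_bigr do rewrite !mxE eqxx /=.
rewrite !mxE eqxx /= -mulr_sumr (bigD1 k) //= eqxx big1 => [|i /negbTE->//].
by rewrite addr0 mulr1 eq_sym; case: (k == j); rewrite ?mulr1 ?mulr0; ring.
Qed.

Lemma arc_point0 j : arc_point j 0 = 0 :> 'rV[R]_n.
Proof. by rewrite /arc_point scale0r. Qed.

Lemma signed_dist0 j : signed_dist j 0 = 0.
Proof. by rewrite -(arc_point0 j) signed_dist_arc eqxx. Qed.

Lemma signed_dist_continuous j : continuous (signed_dist j).
Proof.
move=> p; have FF : Filter (nbhs p) := nbhs_filter p.
apply: cvgB; first by apply: cvgD; exact: coord_continuous.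
by apply: cvg_big => [|k _]; [exact: add_continuous|exact: coord_continuous].
Qed.

Lemma arc_point_continuous j : continuous (arc_point j : R -> 'rV[R]_n).
Proof. exact: scalel_continuous. Qed.

(** Off arc [j] the signed distance is at most [0], and it is [0] only at the center, which also
    lies on arc [j]. *)
Lemma signed_dist_star j p (t : R) : star a p -> 0 <= t ->
  signed_dist j p = t -> p = arc_point j t.
Proof.
move=> [k _ [s /= +] <-] t0; rewrite in_itv /= => /andP[s0 _].
rewrite signed_dist_arc; case: eqP => [-> ->//|_ st].
have -> : s = 0 by lra.
have -> : t = 0 by lra.
by rewrite !arc_point0.
Qed.

(** These are the sets whose Lebesgue measures [star_length] adds up. *)
Definition slice S j : set R := `[0, a j] `&` arc_point j @^-1` S.

Lemma is_interval_signed_dist S j : attack (star a) S ->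
  is_interval (signed_dist j @` S).
Proof.
move=> [_ cS]; apply/connected_intervalP.
apply: connected_continuous_connected => //.
exact/continuous_subspaceT/signed_dist_continuous.
Qed.

Lemma is_interval_slice S j : attack (star a) S -> is_interval (slice S j).
Proof.
move=> attS x y [/= + Sx] [/= + Sy] z /andP[xz zy].
rewrite !in_itv /= => /andP[x0 xa] /andP[y0 ya].
have z0 := le_trans x0 xz.
have [|||p Sp dp] := @is_interval_signed_dist S j attS x y _ _ z.
- by exists (arc_point j x); rewrite // signed_dist_arc eqxx.
- by exists (arc_point j y); rewrite // signed_dist_arc eqxx.
- by rewrite xz.
split=> /=; first by rewrite in_itv /= z0 (le_trans zy).
by rewrite -(@signed_dist_star j p z _ z0 dp) //; exact: attS.1.
Qed.

(** Points on both arcs would give signed distances of both signs (or zero), hence by connectedness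
    a point of [S] at signed distance [0]: the center. *)
Lemma slice_disjoint S j k : attack (star a) S -> ~ S 0 -> k != j ->
  slice S j !=set0 -> slice S k = set0.
Proof.
move=> attS S0 kj [t [/= + St]]; rewrite in_itv /= => /andP[t0 _].
apply/seteqP; split=> // s [/= + Ss]; rewrite in_itv /= => /andP[s0 _].
apply: S0.
have [|||p Sp dp] := @is_interval_signed_dist S j attS (- s) t _ _ 0.
- by exists (arc_point k s); rewrite // signed_dist_arc (negbTE kj).
- by exists (arc_point j t); rewrite // signed_dist_arc eqxx.
- by rewrite oppr_le0 s0.
by rewrite -(arc_point0 j) -(@signed_dist_star j p 0 _ _ dp) //; exact: attS.1.
Qed.

Lemma measurable_slice S j : attack (star a) S -> measurable (slice S j).
Proof.
by move=> attS; apply: is_interval_measurable; exact: is_interval_slice.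
Qed.

Lemma arc_attack j (x : R) : x <= a j ->
  attack (star a) (arc_point j @` `[0, x]).
Proof.
move=> xa; split.
  move=> _ [t /= + <-]; rewrite in_itv /= => /andP[t0 tx].
  by exists j => //; exists t; rewrite //= in_itv /= t0 (le_trans tx).
apply: connected_continuous_connected; first exact: segment_connected.
exact/continuous_subspaceT/arc_point_continuous.
Qed.

Lemma component_attack j : attack (star a) (star_component a j).
Proof.
split.
  move=> _ [t /= +] <-; rewrite in_itv /= => /andP[t0 ta].
  by exists j => //; exists t; rewrite //= in_itv /= ltW.
apply: connected_continuous_connected.
  by apply/connected_intervalP; exact: interval_is_interval.
exact/continuous_subspaceT/arc_point_continuous.
Qed.

(** Written with closed arcs, the block is a union of connected sets through the center; an element
    of [S] puts the center into that union. *)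
Lemma block_attack (S : {set 'I_n}) : (forall j, 0 <= a j) ->
  S != finset.set0 -> attack (star a) (star_block a S).
Proof.
move=> a0 /set0Pn[j0 j0S].
have -> : star_block a S = \bigcup_(j in [set` S]) (arc_point j @` `[0, a j]).
  apply/seteqP; split.
    move=> p [->|[j Sj [t /= + <-]]].
      exists j0 => //; exists 0; last exact: arc_point0.
      by rewrite /= in_itv /= lexx a0.
    rewrite in_itv /= => /andP[t0 ta].
    by exists j => //; exists t; rewrite //= in_itv /= ltW.
  move=> _ [j Sj [t /= + <-]]; rewrite in_itv /= le_eqVlt.
  move=> /andP[/orP[/eqP<-|t0] ta].
    by left; exact: arc_point0.
  by right; exists j => //; exists t; rewrite //= in_itv /= t0.
split; first by apply: bigcup_sub => j _; exact: (arc_attack (lexx _)).1.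
apply: bigcup_connected => [|j _]; last exact: (arc_attack (lexx _)).2.
exists 0 => j _; exists 0; last exact: arc_point0.
by rewrite /= in_itv /= lexx a0.
Qed.
End StarTopology.

(** * The attacker's partition strategy *)

(** [mnormalize] turns a measure into a probability; at total mass 1 it divides by 1, so its
    fallback [dirac x] never arises. *)
Lemma ex_probability d (T : measurableType d) (R : realType)
    (mu : {measure set T -> \bar R}) (x : T) :
  mu setT = 1%E -> exists P : probability T R, forall A, P A = mu A.
Proof.
move=> mu1; exists (mnormalize mu (dirac x)) => A.
by rewrite /= /mnormalize mu1 onee_eq0 /= invr1 mule1.
Qed.

(** A weighted sum of Dirac masses; on [nat] every set is measurable, which later makes the
    measurability of raids trivial. *)
Lemma ex_discrete_probability (R : realType) (N : nat) (c : nat -> R) :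
  (forall k, 0 <= c k) -> \sum_(k < N) c k = 1 ->
  exists P : probability nat R,
    forall A, P A = (\sum_(k < N | (k : nat) \in A) c k)%:E.
Proof.
move=> c0 c1.
pose mu : {measure set nat -> \bar R} :=
  msum (fun k => mscale (NngNum (c0 k)) (dirac k)) N.
have muE A : mu A = (\sum_(k < N | (k : nat) \in A) c k)%:E.
  rewrite /mu /= /msum /mscale /= [in RHS]big_mkcond -sumEFin.
  apply: eq_bigr => k _.
  by rewrite /mscale /= diracE; case: ifP => _; rewrite ?mule1 ?mule0.
have [|P PE] := @ex_probability _ nat R mu 0%N.
  by rewrite muE (eq_bigl xpredT) ?c1 // => k; rewrite in_setT.
by exists P => A; rewrite PE.
Qed.

Section Attacker.
Context {R : realType} {n : nat}.
Variable a : 'I_n -> R.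
Hypothesis a_gt0 : forall j, 0 < a j.
Implicit Types (S : {set 'I_n}) (j k : 'I_n) (o : option 'I_n).

Lemma star_length_ge0 (A : set 'rV[R]_n) : (0 <= star_length a A)%E.
Proof. by apply: sume_ge0 => j _; exact: measure_ge0. Qed.

Lemma star_component0 j : ~ star_component a j 0.
Proof.
case=> t /=; rewrite in_itv /= => /andP[t0 _] /(congr1 (signed_dist j)).
by rewrite signed_dist0 signed_dist_arc eqxx => t00; lra.
Qed.

Lemma star_component_disjoint j k p :
  star_component a j p -> star_component a k p -> j = k.
Proof.
case=> t /= + <- [s /=]; rewrite !in_itv /= => /andP[t0 _] /andP[s0 _].
move/(congr1 (signed_dist k)); rewrite !signed_dist_arc eqxx.
by case: eqP => // _ st; exfalso; lra.
Qed.

Lemma slice_component j k :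
  slice a (star_component a j) k = if k == j then `]0, a j]%classic else set0.
Proof.
apply/seteqP; split=> t.
  case=> /=; rewrite in_itv /= => /andP[t0 ta] [s /=].
  rewrite in_itv /= => /andP[s0 sa] /(congr1 (signed_dist j)).
  rewrite !signed_dist_arc eqxx; case: eqP => [kj <-|_ st]; last lra.
  by rewrite /= in_itv /= s0 sa.
case: eqP => // -> /=; rewrite in_itv /= => /andP[t0 ta].
split; first by rewrite /= in_itv /= ltW.
by exists t; rewrite //= in_itv /= t0.
Qed.

Lemma star_length_slice (A : set 'rV[R]_n) :
  star_length a A = (\sum_j lebesgue_measure (slice a A j))%E.
Proof. by []. Qed.

Lemma star_length_component j : star_length a (star_component a j) = (a j)%:E.
Proof.
rewrite star_length_slice (bigD1 j) //= big1 => [|k /negbTE kj].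
  rewrite slice_component eqxx lebesgue_measure_itv /= lte_fin a_gt0.
  by rewrite oppr0 !adde0.
by rewrite slice_component kj measure0.
Qed.

Lemma slice_block S k :
  slice a (star_block a S) k = if k \in S then `[0, a k]%classic else [set 0].
Proof.
apply/seteqP; split=> t.
  case=> /= t0a [t00|[j jS [s /=]]].
    have t0 : t = 0.
      have := congr1 (signed_dist k) t00.
      by rewrite signed_dist0 signed_dist_arc eqxx.
    by case: ifP => // _; rewrite t0 /= in_itv /= lexx ltW.
  rewrite in_itv /= => /andP[s0 sa] /(congr1 (signed_dist k)).
  rewrite !signed_dist_arc eqxx; case: eqP => [<- <-|_ st].
    by rewrite jS /= in_itv /= ltW.
  by move: t0a; rewrite in_itv /= => /andP[]; lra.
case: ifP => [kS /= t0a|_ ->].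
  split=> //; move: t0a; rewrite in_itv /= le_eqVlt.
  move=> /andP[/orP[/eqP<-|t0] ta].
    by left; exact: arc_point0.
  by right; exists k => //; exists t; rewrite //= in_itv /= t0.
by split; [rewrite /= in_itv /= lexx ltW|left; exact: arc_point0].
Qed.

Lemma star_length_block S :
  star_length a (star_block a S) = (\sum_(j in S) a j)%:E.
Proof.
rewrite star_length_slice -sumEFin [RHS]big_mkcond; apply: eq_bigr => k _.
rewrite slice_block; case: ifP => _; last by rewrite lebesgue_measure_set1.
by rewrite lebesgue_measure_itv /= lte_fin a_gt0 oppr0 adde0.
Qed.

(* [None] stands for the block [S], [Some i] for the component [i]. *)
Definition pieces S : pred (option 'I_n) :=
  fun o => if o is Some i then i \notin S else true.

Definition piece S o : set 'rV[R]_n :=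
  if o is Some i then star_component a i else star_block a S.

Definition piece_length S o : R :=
  if o is Some i then a i else \sum_(j in S) a j.

Lemma star_length_piece S o :
  star_length a (piece S o) = (piece_length S o)%:E.
Proof.
by case: o => [i|]; [exact: star_length_component|exact: star_length_block].
Qed.

Lemma piece_length_gt0 S o : S != finset.set0 -> 0 < piece_length S o.
Proof.
case/set0Pn=> j jS; case: o => [i|] //=.
by rewrite (bigD1 j) //= ltr_wpDr // sumr_ge0 // => i _; exact: ltW.
Qed.

Lemma sum_pieces (V : nmodType) S (F : option 'I_n -> V) :
  \sum_(o | pieces S o) F o = \sum_(i | i \notin S) F (Some i) + F None.
Proof.
rewrite (bigD1 None) //= addrC; congr (_ + _).
rewrite (reindex_omap (op := GRing.add) Some id) /=; last by case.
by apply: eq_bigl => i; rewrite !eqxx !andbT.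
Qed.

Lemma partition_DE S :
  partition_D a S = \sum_(o | pieces S o) (piece_length S o)^-1.
Proof. by rewrite sum_pieces. Qed.

Lemma partition_D_gt0 S : S != finset.set0 -> 0 < partition_D a S.
Proof.
move=> S0; rewrite partition_DE (bigD1 None) //= ltr_wpDr //.
  by rewrite sumr_ge0 // => o _; rewrite invr_ge0 ltW // piece_length_gt0.
by rewrite invr_gt0 (piece_length_gt0 None S0).
Qed.

Lemma piece_disjoint S o o1 p : pieces S o -> pieces S o1 ->
  piece S o p -> piece S o1 p -> o = o1.
Proof.
have sc i : i \notin S -> star_component a i p -> star_block a S p -> False.
  move=> iS ip [p0|[j jS jp]].
    by move: ip; rewrite p0 => /star_component0.
  by move: iS; rewrite (star_component_disjoint ip jp) jS.
case: o o1 => [i|] [k|] //= iS kS.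
- by move=> ip kp; rewrite (star_component_disjoint ip kp).
- by move=> ip pS; case: (sc i).
- by move=> pS kp; case: (sc k).
Qed.

Lemma piece_cover S p : star a p -> exists2 o, pieces S o & piece S o p.
Proof.
case=> j _ [t /=]; rewrite in_itv /= le_eqVlt => /andP[/orP[/eqP<- _|t0 ta]] <-.
  by exists None => //; left; rewrite /arc_point scale0r.
have jp : star_component a j (arc_point j t).
  by exists t; rewrite //= in_itv /= t0.
have [jS|jS] := boolP (j \in S); last by exists (Some j).
by exists None => //; right; exists j.
Qed.

Lemma piece_neq0 S o : piece S o !=set0.
Proof.
case: o => [i|]; last by exists 0; left.
by exists (arc_point i (a i)); exists (a i); rewrite //= in_itv /= a_gt0 lexx.
Qed.

Lemma partition_payoff S (s : attacker_strategy (star a) (star_length a)) q :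
  S != finset.set0 -> partition_law S s -> star a q ->
  ((partition_W a S)%:E <= attacker_payoff s q)%E.
Proof.
move=> S0 [law1 law2] Qq; rewrite /attacker_payoff.
(* [p0] is the piece holding the trap; a raid on any other piece earns its full length. *)
have [p0 Po0 qo0] := piece_cover S Qq.
pose E o := [set w | raid (a := s) w = piece S o].
have law o : pieces S o -> measurable (E o) /\
    raid_prob s (E o) = ((piece_length S o)^-1 / partition_D a S)%:E.
  by case: o => [i|] //=; exact: law1.
have D0 := partition_D_gt0 S0.
pose mE := fun o (h : pieces S o) => (law o h).1.
pose other o := pieces S o && (o != p0).
pose f o w := (piece_length S o * \1_(E o) w)%:E : \bar R.
have mf o : other o -> measurable_fun setT (f o).
  move=> /andP[Po _]; apply/measurable_EFinP; apply: measurable_funM => //.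
  exact/measurable_indic/mE.
pose g o w := if other o then f o w else 0%E.
have mg o : measurable_fun setT (g o).
  by rewrite /g; case oo: (other o) => //; exact: mf.
have g0 o w : (0 <= g o w)%E.
  rewrite /g; case: ifP => // _.
  by rewrite lee_fin mulr_ge0 // ltW // piece_length_gt0.
have -> : partition_W a S = \sum_(o | other o) (partition_D a S)^-1.
  rewrite /partition_W.
  have -> : (n - #|S|)%:R = \sum_(o | other o) (1 : R).
    (* The pieces are the [n - #|S|] single components and the block; discarding [p0] leaves
       [n - #|S|]. *)
    have : (\sum_(o | pieces S o) 1 = (n - #|S|).+1)%N.
      rewrite [LHS](sum_pieces S (fun=> 1%N)) sum1_card -[LHS]/(_ + 1)%N addn1.
      congr _.+1.
      by rewrite -[X in (X - _)%N]card_ord -(cardC S) addKn.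
    by rewrite (bigD1 p0) //= add1n => -[<-]; rewrite natr_sum.
  by rewrite mulr_suml; apply: eq_bigr => o _; rewrite mul1r.
rewrite -sumEFin.
apply: (@le_trans _ _ (\int[raid_prob s]_w (\sum_o g o w))%E).
  rewrite ge0_integral_sum //= big_mkcond; apply: lee_sum => o _.
  rewrite /g; case oo: (other o); last by rewrite integral0.
  have Po : pieces S o by case/andP: oo.
  (* A side condition of [integralZl_indic] about negative factors, vacuous here. *)
  have E0 : piece_length S o < 0 -> E o = set0.
    by rewrite ltNge ltW // piece_length_gt0.
  rewrite /f.
  rewrite (@integralZl_indic _ _ _ _ _ measurableT (fun=> E o) _ E0 (mE o Po)).
  rewrite integral_indic //; last exact: mE.
  rewrite setIT [X in (_ * X)%E](law o Po).2 -EFinM lee_fin.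
  rewrite mulrA mulfV ?mul1r //.
  by rewrite gt_eqF // piece_length_gt0.
apply: ge0_le_integral => //=.
- by move=> w _; rewrite sume_ge0.
- exact: emeasurable_sum.
- exact: raid_measurable.
move=> w _.
have pos : (0 <= payoff (star_length a) q (raid (a := s) w))%E.
  by rewrite /payoff; case: ifP => // _; exact: star_length_ge0.
(* Pieces are nonempty and disjoint, so at most one event [E o] contains [w]. In that case the sum
   is the length of the raid, which misses [q]; otherwise it is [0]. *)
have [[ o /andP[oo wo]]|none] := pselect (exists o, other o && (w \in E o)).
  rewrite (bigD1 o) //= big1 => [|o1 o1o].
    have [Po oo0] := andP oo; move: wo; rewrite inE /E /= => wo.
    rewrite adde0 /g oo /f indicE mem_set // mulr1 /payoff wo star_length_piece.
    case: ifPn => //; rewrite inE => qo; exfalso; move/eqP: oo0; apply.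
    exact: (piece_disjoint Po Po0 qo qo0).
  rewrite /g; case: ifP => // /andP[Po1 _]; rewrite /f indicE memNset ?mulr0 //.
  move: wo; rewrite inE /E /= => -> wE; have [p po] := piece_neq0 S o.
  move/eqP: o1o; apply; have [Po _] := andP oo.
  by apply: (piece_disjoint Po1 Po _ po); rewrite -wE.
rewrite big1 // => o _; rewrite /g; case: ifP => // oo.
rewrite /f indicE memNset ?mulr0 // => wo; apply: none; exists o.
by rewrite oo mem_set.
Qed.

Lemma partition_law_exists S : S != finset.set0 ->
  exists s : attacker_strategy (star a) (star_length a), partition_law S s.
Proof.
move=> S0; have D0 := partition_D_gt0 S0.
pose weight o :=
  if pieces S o then (piece_length S o)^-1 / partition_D a S else 0.
(* Outcomes [k < n] stand for the components and [n] for the block; larger outcomes get no mass. *)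
pose idx (k : nat) : option 'I_n := insub k.
have w0 o : 0 <= weight o.
  rewrite /weight; case: ifP => // _.
  by rewrite divr_ge0 ?invr_ge0 ?ltW // piece_length_gt0.
have idxE (i : 'I_n) : idx i = Some i by rewrite /idx valK.
have idxn : idx n = None by rewrite /idx insubF // ltnn.
have [|P PE] :=
  @ex_discrete_probability R n.+1 (weight \o idx) (fun m => w0 (idx m)).
  rewrite big_ord_recr /= idxn; under eq_bigr do rewrite idxE.
  rewrite {2}/weight /= big_mkcond /=.
  transitivity (\sum_(o | pieces S o) (piece_length S o)^-1 / partition_D a S).
    by rewrite sum_pieces /= [in RHS]big_mkcond.
  by rewrite -mulr_suml -partition_DE mulfV // gt_eqF.
pose raid m := piece S (idx m).
have raid_law o : pieces S o ->
    P [set m | raid m = piece S o] =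
      ((piece_length S o)^-1 / partition_D a S)%:E.
  move=> Po; have -> : (piece_length S o)^-1 / partition_D a S = weight o.
    by rewrite /weight Po.
  have raid_eq m : pieces S (idx m) ->
      (m \in [set m | raid m = piece S o]) = (idx m == o).
    move=> Pm; apply/idP/eqP => [|<-]; rewrite inE //= => mo.
    have [p po] := piece_neq0 S o.
    by apply: (piece_disjoint Pm Po _ po); rewrite /raid in mo; rewrite mo.
  (* Components inside [S] have weight [0], so the event may be replaced by [idx m == o] under the
     sum. *)
  have total : \sum_(m < n.+1 | (m : nat) \in [set m | raid m = piece S o])
      (weight \o idx) m = \sum_(m < n.+1 | idx m == o) weight (idx m).
    rewrite [LHS]big_mkcond [RHS]big_mkcond; apply: eq_bigr => m _ /=.
    have [Pm|Pm] := boolP (pieces S (idx m)); first by rewrite raid_eq.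
    by rewrite /weight (negbTE Pm) !if_same.
  rewrite PE total; congr (_%:E); case: o Po {raid_eq total} => [i _|_].
    rewrite (big_pred1 (widen_ord (leqnSn n) i)) /= ?idxE // => m /=.
    rewrite -val_eqE /= /idx; case: insubP => [j _ <-|] //=.
    rewrite -leqNgt => nm; apply/esym/negbTE.
    by rewrite neq_ltn (leq_trans (ltn_ord i) nm) orbT.
  rewrite (big_pred1 ord_max) /= ?idxn // => m /=.
  rewrite -val_eqE /= /idx; case: insubP => [j jn <-|] /=.
    by rewrite ltn_eqF // ltn_ord.
  rewrite -leqNgt => nm; apply/esym.
  by rewrite eqn_leq nm -ltnS ltn_ord.
have raidA m : attack (star a) (raid m).
  rewrite /raid; case: (idx m) => [i|]; first exact: component_attack.
  by apply: block_attack => // j; exact: ltW.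
have raidM q : star a q ->
    measurable_fun setT (fun m => payoff (star_length a) q (raid m)) by [].
exists (AttackerStrategy P raidA raidM); split=> [i iS|]; split=> //.
  exact: (raid_law (Some i)).
exact: (raid_law None).
Qed.
End Attacker.

(** * The defender's guarantee *)

Section Defender.
Context {R : realType} {n : nat}.
Variable a : 'I_n -> R.
Hypothesis a_gt0 : forall j, 0 < a j.
Hypothesis a_lt : forall j, a j < 2^-1.
Implicit Types (S : set 'rV[R]_n) (j k : 'I_n).

Lemma trap_cdf0 j : trap_cdf a j 0 = 0.
Proof. by rewrite /trap_cdf mulr0 mul0r; apply/min_idPr; exact: ltW. Qed.

Lemma le_trap_cdf j (x y : R) : x <= y -> trap_cdf a j x <= trap_cdf a j y.
Proof.
move=> xy; rewrite /trap_cdf le_min ge_min lexx /= ge_min; apply/orP; right.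
rewrite ler_pM2r ?invr_gt0 // ler_wpM2l // subr_ge0.
by have := a_lt j; lra.
Qed.

Lemma arc_point_inj j : injective (arc_point j : R -> 'rV[R]_n).
Proof.
by move=> s t /(congr1 (signed_dist j)); rewrite !signed_dist_arc eqxx.
Qed.

(** The bounds are [inf T] and [sup T]. They may lie outside [T], so only the open interval between
    them is claimed to be inside. *)
Lemma interval_bounds (T : set R) (c : R) : is_interval T -> T !=set0 ->
  T `<=` `[0, c] ->
  exists u v, [/\ 0 <= u, u <= v, v <= c, T `<=` `[u, v] &
    forall t, u < t < v -> T t].
Proof.
move=> iT [x Tx] Tc.
have lT : has_lbound T.
  by exists 0 => t /Tc /=; rewrite in_itv /= => /andP[].
have uT : has_ubound T.
  by exists c => t /Tc /=; rewrite in_itv /= => /andP[].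
have T0 : T !=set0 by exists x.
exists (inf T), (sup T); split.
- by apply: lb_le_inf => // t /Tc /=; rewrite in_itv /= => /andP[].
- by rewrite (@le_trans _ _ x) //; [exact: ge_inf|exact: ub_le_sup].
- by apply: ge_sup => // t /Tc /=; rewrite in_itv /= => /andP[].
- by move=> t Tt; rewrite /= in_itv /= ge_inf // ub_le_sup.
- move=> t tT; suff : T° t by exact: interior_subset.
  by rewrite interval_bounded_interior.
Qed.

(** The right end is pulled in by up to [e], so that []u, v]] lies in the slice even when the
    supremum is not attained; half-open intervals have a trap probability that is a difference of
    cdf values. *)
Lemma slice_approx S j (e : R) : attack (star a) S -> 0 < e ->
  exists u v, [/\ 0 <= u <= v, v <= a j,
    forall t, u < t <= v -> S (arc_point j t),
    (lebesgue_measure (slice a S j) <= (v - u + e)%:E)%E & S 0 -> u = 0].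
Proof.
move=> attS e0; have [->|/set0P sl0] := eqVneq (slice a S j) set0.
  exists 0, 0; split; [by rewrite lexx|exact: ltW| | |by []].
    by move=> t /andP[t0 /(lt_le_trans t0)]; rewrite ltxx.
  by rewrite measure0 lee_fin subrr add0r ltW.
have [|u [v [u0 uv va Suv uvS]]] :=
  interval_bounds (is_interval_slice (j := j) attS) sl0 (c := a j).
  by move=> t [].
have le_slice : (lebesgue_measure (slice a S j) <= (v - u)%:E)%E.
  apply: (@le_trans _ _ (lebesgue_measure (`[u, v]%classic : set R))).
    by apply: le_measure; rewrite ?inE //; exact: measurable_slice.
  rewrite lebesgue_measure_itv /= lte_fin; case: ifP => _.
    by rewrite -EFinB lexx.
  by rewrite lee_fin subr_ge0.
have u00 : S 0 -> u = 0.
  move=> S0; have /Suv : slice a S j 0.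
    by split; rewrite /= ?arc_point0 // in_itv /= lexx ltW.
  by rewrite /= in_itv /= => /andP[ule0 _]; lra.
exists u, (Num.max u (v - e)); split=> //.
- by rewrite u0 le_max lexx.
- by rewrite ge_max (le_trans uv) //=; lra.
- move=> t /andP[ut]; rewrite le_max leNgt ut /= => tv.
  have [] // : slice a S j t by apply: uvS; rewrite ut /=; lra.
- apply: le_trans le_slice _; rewrite lee_fin.
  have : v - e <= Num.max u (v - e) by rewrite le_max lexx orbT.
  lra.
Qed.

Section Guarantee.
Variable s : defender_strategy (star a) (star_length a).
Hypothesis law : trap_law s.

Definition trap_at j (I : set R) : set (trap_space s) :=
  [set w | (arc_point j @` I) (trap (d := s) w)].

Lemma trap_interval j (u v : R) : 0 <= u <= v -> v <= a j ->
  measurable (trap_at j `]u, v]) /\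
  trap_prob s (trap_at j `]u, v]) = (trap_cdf a j v - trap_cdf a j u)%:E.
Proof.
move=> /andP[u0 uv] va.
have [mu Pu] := @law j u ltac:(by rewrite u0 (le_trans uv)).
have [mv Pv] := @law j v ltac:(by rewrite va (le_trans u0)).
have -> : trap_at j `]u, v] = trap_at j `[0, v] `\` trap_at j `[0, u].
  apply/seteqP; split=> w /=.
    case=> t /=; rewrite in_itv /= => /andP[ut tv] tw; split.
      by exists t; rewrite //= in_itv /= tv (le_trans u0) // ltW.
    case=> r /= + rw; rewrite -tw in rw; rewrite (arc_point_inj rw) in_itv /=.
    by move=> /andP[_]; rewrite leNgt ut.
  case=> -[t tI tw] ntu; move: tI; rewrite /= in_itv /= => /andP[t0 tv].
  exists t => //.
  rewrite /= in_itv /= tv andbT ltNge; apply/negP => tu; apply: ntu.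
  by exists t; rewrite //= in_itv /= t0.
split; first exact: measurableD.
rewrite measureD //; last by rewrite ltey_eq fin_num_measure.
have -> : trap_at j `[0, v] `&` trap_at j `[0, u] = trap_at j `[0, u].
  apply/setIidPr => w [t + tw]; rewrite /= in_itv /= => /andP[t0 tu].
  by exists t; rewrite //= in_itv /= t0 (le_trans tu).
by rewrite [X in (X - _)%E]Pv [X in (_ - X)%E]Pu EFinB.
Qed.

(** The payoff is [0] on [E] and at most [l] elsewhere. An inclusion for [E] suits slices known only
    up to their ends. *)
Lemma defender_payoff_le S (E : set (trap_space s)) (l p : R) :
  attack (star a) S -> measurable E -> E `<=` [set w | S (trap (d := s) w)] ->
  trap_prob s E = p%:E -> (star_length a S <= l%:E)%E ->
  (defender_payoff s S <= (l * (1 - p))%:E)%E.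
Proof.
move=> attS mE ES PE Sl; rewrite /defender_payoff.
have l0 : 0 <= l by rewrite -lee_fin (le_trans _ Sl) // star_length_ge0.
have mEC : measurable (~` E) by exact: measurableC.
have -> : (l * (1 - p))%:E =
    (\int[trap_prob s]_w (l * \1_(~` E) w)%:E)%E.
  rewrite (@integralZl_indic _ _ _ _ _ measurableT (fun=> ~` E)) //; last first.
    by rewrite ltNge l0.
  rewrite integral_indic // setIT.
  rewrite [X in (_ * X)%E](probability_setC (trap_prob s) mE).
  by rewrite [X in (_ * (_ - X))%E]PE -EFinB -EFinM.
apply: ge0_le_integral => //=.
- move=> w _; rewrite /payoff; case: ifP => // _; exact: star_length_ge0.
- exact: trap_measurable.
- by apply/measurable_EFinP; apply: measurable_funM.
move=> w _; rewrite /payoff; case: ifPn => Sw.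
  by rewrite lee_fin mulr_ge0.
rewrite indicE mem_set ?mulr1 // => Ew; move/negP: Sw; apply.
by rewrite inE; exact: ES.
Qed.

Lemma center_payoff_le S (e : R) : attack (star a) S -> S 0 -> 0 < e ->
  exists v : 'I_n -> R, (forall j, 0 <= v j <= a j) /\
  (defender_payoff s S <=
   ((\sum_j v j + n%:R * e) * (1 - \sum_j trap_cdf a j (v j)))%:E)%E.
Proof.
move=> attS S0 e0.
have /choice[v vP] : forall j, exists v, [/\ 0 <= v <= a j,
    forall t, 0 < t <= v -> S (arc_point j t) &
    (lebesgue_measure (slice a S j) <= (v + e)%:E)%E].
  move=> j; have [u [v [/andP[u0 uv] va Suv lv /(_ S0) u00]]] :=
    slice_approx j attS e0.
  by exists v; split; [rewrite va -u00 uv|rewrite -u00|rewrite u00 subr0 in lv].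
have tI j : measurable (trap_at j `]0, v j]) /\
    trap_prob s (trap_at j `]0, v j]) = (trap_cdf a j (v j))%:E.
  have [/andP[v0 va] _ _] := vP j.
  have [|//|m ->] := @trap_interval j 0 (v j); first by rewrite lexx.
  by rewrite trap_cdf0 subr0.
exists v; split=> [j|]; first by have [] := vP j.
(* Leaving out the center makes the events of different arcs disjoint, and costs nothing because the
   cdf vanishes at [0]. *)
apply: (@defender_payoff_le _
  (\big[setU/set0]_(j < n) trap_at j `]0, v j])) => //.
- by apply: bigsetU_measurable => j _; exact: (tI j).1.
- elim/big_ind: _ => // [A B SA SB w [/SA|/SB]|j _ w [t /= + <-]] //.
  by rewrite in_itv /=; have [_ + _] := vP j; exact.
- rewrite measure_bigsetU_ord //.
  + by rewrite -sumEFin; apply: eq_bigr => j _; exact: (tI j).2.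
  + by move=> j; exact: (tI j).1.
  apply/trivIsetP => j k _ _ jk; apply/seteqP; split=> // w [].
  case=> t /=; rewrite in_itv /= => /andP[t0 _] tw [r /=].
  rewrite in_itv /= -tw => /andP[r0 _] /(congr1 (signed_dist k)).
  by rewrite !signed_dist_arc eqxx (negbTE jk) => rt; lra.
rewrite star_length_slice.
have -> : \sum_j v j + n%:R * e = \sum_j (v j + e).
  by rewrite big_split /= sumr_const card_ord mulr_natl.
by rewrite -sumEFin; apply: lee_sum => j _; have [] := vP j.
Qed.

(** By [slice_disjoint] a single slice carries the whole length; the first alternative covers the
    empty raid. *)
Lemma arc_payoff_le S (e : R) : attack (star a) S -> ~ S 0 -> 0 < e ->
  (defender_payoff s S <= 0)%E \/
  exists j u v, [/\ 0 <= u, u <= v, v <= a j &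
  (defender_payoff s S <=
   ((v - u + e) * (1 - (trap_cdf a j v - trap_cdf a j u)))%:E)%E].
Proof.
move=> attS S0 e0.
have [[j jS]|none] := pselect (exists j, slice a S j !=set0); last first.
  left; have := @defender_payoff_le S set0 0 0 attS measurable0
    (@sub0set _ _) (measure0 _).
  rewrite mul0r; apply.
  rewrite star_length_slice big1 // => j _.
  rewrite (_ : slice a S j = set0) ?measure0 //.
  by apply/seteqP; split=> // t jt; apply: none; exists j, t.
right; have [u [v [/andP[u0 uv] va Suv lv _]]] := slice_approx j attS e0.
exists j, u, v; split=> //.
have [|//|m P] := @trap_interval j u v; first by rewrite u0.
apply: (defender_payoff_le attS m _ P).
  by move=> w [t /=]; rewrite in_itv /= => /Suv + <-.
rewrite star_length_slice (bigD1 j) //= big1 ?adde0 // => k kj.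
by rewrite (slice_disjoint attS S0 kj jS) measure0.
Qed.
End Guarantee.
End Defender.

(** * Existence of the trap law *)

Section DefenderExistence.
Context {R : realType} {n : nat}.
Variable a c : 'I_n -> R.
Hypothesis a_gt0 : forall j, 0 < a j.
Hypothesis a_lt : forall j, a j < 2^-1.
Hypothesis c_itv : forall j, 0 <= c j <= 1 - a j.
Hypothesis c_disjoint : forall (w : R) j k,
  c j < w <= c j + a j -> c k < w <= c k + a k -> j = k.
Hypothesis c_cover : forall w : R, 0 < w <= 1 -> exists j, c j < w <= c j + a j.
Implicit Types (S : set 'rV[R]_n) (j k : 'I_n) (w : R).

Let dist j w := (w - c j) * a j / (1 - a j).

(* For [w] uniform in ]0, 1], [trap_of w] has the law [trap_cdf]: arc [j] owns
   the interval ]c j, c j + a j], on which the inverse of the increasing part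
   of [trap_cdf a j] is applied. *)
Definition trap_of w : 'rV[R]_n :=
  if [pick j | c j < w <= c j + a j] is Some j then arc_point j (dist j w)
  else 0.

Lemma trap_of_in j w :
  c j < w <= c j + a j -> trap_of w = arc_point j (dist j w).
Proof.
move=> jw; rewrite /trap_of; case: pickP => [k kw|/(_ j)]; last by rewrite jw.
by rewrite (c_disjoint kw jw).
Qed.

Lemma trap_of_out w : (forall j, ~~ (c j < w <= c j + a j)) -> trap_of w = 0.
Proof.
move=> out; rewrite /trap_of; case: pickP => // j jw.
by move: (out j); rewrite jw.
Qed.

Lemma dist_gt0 j w : c j < w -> 0 < dist j w.
Proof.
move=> jw; rewrite /dist divr_gt0 ?mulr_gt0 ?subr_gt0 //.
by have := a_lt j; lra.
Qed.

(** The right side involves the unclipped branch of [trap_cdf a j x]; events on the distance thus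
    become intervals of [w]. *)
Lemma dist_le j w (x : R) :
  (dist j w <= x) = (w <= c j + (1 - a j) * x / a j).
Proof.
rewrite /dist ler_pdivrMr; last by have := a_lt j; lra.
by rewrite -ler_pdivlMr // lerBlDl (mulrC x).
Qed.

Lemma trap_of_star w : star a (trap_of w).
Proof.
have a0 j : 0 <= a j by exact: ltW.
have [[j jw]|out] := pselect (exists j, c j < w <= c j + a j).
  rewrite (trap_of_in jw); exists j => //; exists (dist j w) => //.
  have /andP[cw wa] := jw.
  rewrite /= in_itv /= (ltW (dist_gt0 cw)) dist_le (le_trans wa) //.
  rewrite lerD2l mulfK ?gt_eqF //; have := a_lt j; lra.
(* The center is in the star only if some arc exists; covering the point [1] yields one. *)
have [|j _] := c_cover (w := 1); first by rewrite ltr01 lexx.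
rewrite trap_of_out => [|k]; last by apply/negP => kw; apply: out; exists k.
by exists j => //; exists 0; [rewrite /= in_itv /= lexx a0|exact: arc_point0].
Qed.

Lemma measurable_trap_of S : attack (star a) S ->
  measurable (trap_of @^-1` S).
Proof.
move=> attS; pose I j := `]c j, c j + a j]%classic : set R.
have mI j : measurable (I j) by exact: measurable_itv.
have mdist j : measurable_fun setT (dist j).
  apply: measurable_funM => //; apply: measurable_funM => //.
  exact: measurable_funB.
(* A finite union of preimages of intervals, plus the points owned by no arc, which [trap_of] sends
   to the center. *)
have -> : trap_of @^-1` S =
    (\bigcup_j (I j `&` dist j @^-1` slice a S j)) `|`
    (if `[< S 0 >] then ~` (\bigcup_j I j) else set0).
  apply/seteqP; split=> w /=.
    move=> Sw; have [[j jw]|out] := pselect (exists j, c j < w <= c j + a j).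
      left; exists j => //; split; first by rewrite /I /= in_itv.
      move: Sw; rewrite (trap_of_in jw) => Sw; split=> //=.
      have /andP[cw wa] := jw.
      rewrite in_itv /= (ltW (dist_gt0 cw)) dist_le (le_trans wa) //.
      rewrite lerD2l mulfK ?gt_eqF //; have := a_lt j; lra.
    right; move: Sw; rewrite trap_of_out => [S0|k]; last first.
      by apply/negP => kw; apply: out; exists k.
    rewrite asboolT // => -[j _ jw]; apply: out; exists j.
    by move: jw; rewrite /I /= in_itv.
  case=> [[j _ [jw [_ Sj]]]|].
    by rewrite (@trap_of_in j) //; move: jw; rewrite /I /= in_itv.
  case: asboolP => // S0 out; rewrite trap_of_out // => j; apply/negP => jw.
  by apply: out; exists j => //; rewrite /I /= in_itv.
have mU F : (forall j, measurable (F j : set R)) -> measurable (\bigcup_j F j).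
  by move=> mF; apply: fin_bigcup_measurable => //; exact: finite_finset.
apply: measurableU.
  apply: mU => j; apply: measurableI => //.
  rewrite -[X in measurable X]setTI; apply: mdist => //.
  exact: measurable_slice.
by case: ifP => _ //; apply: measurableC; exact: mU.
Qed.

Lemma trap_law_exists :
  exists s : defender_strategy (star a) (star_length a), trap_law s.
Proof.
(* The uniform law on []0, 1]], with the whole line as sample space. *)
pose mu := mrestr (@lebesgue_measure R) (measurable_itv `]0, 1]).
have [|P PE] := @ex_probability _ _ R mu 0.
  rewrite /mu /= /mrestr setTI lebesgue_measure_itv /= lte_fin ltr01.
  by rewrite oppr0 adde0.
have mt S : attack (star a) S ->
    measurable_fun setT (fun w => payoff (star_length a) (trap_of w) S).
  move=> attS; apply: measurable_fun_ifT => //.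
  apply: (measurable_fun_bool true); rewrite setTI.
  rewrite (_ : _ @^-1` _ = trap_of @^-1` S); first exact: measurable_trap_of.
  by apply/seteqP; split=> w /=; [move/set_mem|move/mem_set].
exists (DefenderStrategy P trap_of_star mt) => j x /andP[x0 xa] /=.
have arc_attack : attack (star a) (arc_point j @` `[0, x]) by exact: arc_attack.
split; first exact: (measurable_trap_of arc_attack).
rewrite PE /mu /= /mrestr.
have cdf0 : 0 <= trap_cdf a j x.
  by rewrite -(trap_cdf0 a_gt0 j) (le_trap_cdf a_gt0).
(* Within []0, 1]] the event is an interval whose length is the required probability. *)
rewrite (_ : _ `&` _ = `]c j, c j + trap_cdf a j x]%classic).
  rewrite lebesgue_measure_itv /= lte_fin ltrDl -EFinB addrC addKr.
  case: ifPn => //; rewrite -leNgt => cdf1; congr (_%:E); apply/eqP.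
  by rewrite eq_le cdf0.
have cdf_le : trap_cdf a j x <= a j by rewrite /trap_cdf ge_min lexx.
apply/seteqP; split=> w /=; rewrite !in_itv /=.
  case=> -[t /=]; rewrite in_itv /= => /andP[t0 tx] tw w01.
  have [k kw] := c_cover w01; have /andP[cw wa] := kw.
  move: tw; rewrite (trap_of_in kw) => tw.
  (* If [w] were owned by another arc [k], then [t] would equal [- dist k w], which is negative. *)
  have := congr1 (signed_dist k) tw; have := congr1 (signed_dist j) tw.
  rewrite !signed_dist_arc eqxx [k == j]eq_sym; have := dist_gt0 cw.
  case: eqP => [jk _ td _|_ d0 td _]; last by lra.
  move: tx; rewrite td -jk in cw wa *; rewrite dist_le => wx.
  by rewrite cw /trap_cdf /Num.min; case: ifP.
move=> /andP[cw wc].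
have jw : c j < w <= c j + a j by rewrite cw (le_trans wc) // lerD2l.
have /andP[c0 c1] := c_itv j.
split; last by rewrite (le_lt_trans c0) //; lra.
rewrite (trap_of_in jw); exists (dist j w) => //.
rewrite /= in_itv /= (ltW (dist_gt0 cw)) dist_le (le_trans wc) // lerD2l.
by rewrite /trap_cdf ge_min lexx orbT.
Qed.
End DefenderExistence.

(** * Three arcs *)

Local Notation i0 := (@Ordinal 3 0 isT).
Local Notation i1 := (@Ordinal 3 1 isT).
Local Notation i2 := (@Ordinal 3 2 isT).

Lemma ord3_ind (P : 'I_3 -> Prop) : P i0 -> P i1 -> P i2 -> forall j, P j.
Proof.
move=> p0 p1 p2 [[|[|[|//]]] lt].
- by rewrite (_ : Ordinal lt = i0) //; exact: val_inj.
- by rewrite (_ : Ordinal lt = i1) //; exact: val_inj.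
- by rewrite (_ : Ordinal lt = i2) //; exact: val_inj.
Qed.

Lemma sum_ord3 (V : nmodType) (F : 'I_3 -> V) : \sum_j F j = F i0 + F i1 + F i2.
Proof.
rewrite !big_ord_recl big_ord0 addr0 addrA.
by congr (F _ + F _ + F _); exact: val_inj.
Qed.

Section ThreeArcs.
Context {R : realType}.
Variable a : 'I_3 -> R.
Hypothesis arcs : [/\ a i1 <= a i0, a i2 <= a i1, 0 < a i2,
  a i0 + a i1 + a i2 = 1 & a i0 < 2^-1].

Let a_gt0 j : 0 < a j.
Proof. by have [? ? ? ? ?] := arcs; elim/ord3_ind: j => //; lra. Qed.

Let a_lt j : a j < 2^-1.
Proof. by have [? ? ? ? ?] := arcs; elim/ord3_ind: j => //; lra. Qed.

Let a_le j : a j <= a i0.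
Proof. by have [? ? ? ? ?] := arcs; elim/ord3_ind: j => //; lra. Qed.

Lemma trap_law_exists3 :
  exists s : defender_strategy (star a) (star_length a), trap_law s.
Proof.
have [? ? ? ? ?] := arcs.
(* Left ends of intervals of lengths [a i0], [a i1], [a i2] laid end to end in []0, 1]]. *)
pose c : 'I_3 -> R := tnth [tuple 0; a i0; a i0 + a i1].
have c0E : c i0 = 0 by [].
have c1E : c i1 = a i0 by [].
have c2E : c i2 = a i0 + a i1 by [].
apply: (trap_law_exists (c := c) a_gt0 a_lt).
- by elim/ord3_ind; rewrite ?c0E ?c1E ?c2E; lra.
- by move=> w; elim/ord3_ind; elim/ord3_ind => //; rewrite ?c0E ?c1E ?c2E;
    move=> wj wk; exfalso; lra.
move=> w w01; have [w1|w1] := leP w (a i0).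
  by exists i0; rewrite c0E; lra.
have [w2|w2] := leP w (a i0 + a i1).
  by exists i1; rewrite c1E; lra.
by exists i2; rewrite c2E; lra.
Qed.

Lemma trap_law_guarantees (s : defender_strategy (star a) (star_length a)) :
  trap_law s -> defender_guarantees s (a i0 * (1 - a i0)).
Proof.
have [le10 le21 a20 sum_a a0_lt] := arcs.
move=> law S attS; apply/lee_addgt0Pr => e e0.
(* Each of the three slices may be off by [e / 3]. *)
have e30 : 0 < e / 3 by lra.
have [S0|S0] := pselect (S 0).
  have [v [vP]] := center_payoff_le a_gt0 law attS S0 e30.
  move/le_trans; apply; rewrite -EFinD lee_fin !sum_ord3.
  have := raid_center_le le10 le21 a20 sum_a a0_lt (vP i0) (vP i1) (vP i2).
  (* Nonnegative cdf values keep the escape factor at most 1, so the length error [e] adds at most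
     [e] to the payoff. *)
  have cdf_ge0 j : 0 <= trap_cdf a j (v j).
    rewrite -(trap_cdf0 a_gt0 j) (le_trap_cdf a_gt0) //.
    by have /andP[] := vP j.
  have := cdf_ge0 i0; have := cdf_ge0 i1; have := cdf_ge0 i2.
  rewrite -[clipped (a i0) _]/(trap_cdf a i0 _).
  rewrite -[clipped (a i1) _]/(trap_cdf a i1 _).
  rewrite -[clipped (a i2) _]/(trap_cdf a i2 _).
  move: (trap_cdf _ _ _) (trap_cdf _ _ _) (trap_cdf _ _ _) => x y z.
  by rewrite (mulrC 3%:R) divfK //; nra.
have [le0|[j [u [v [u0 uv va le_pay]]]]] := arc_payoff_le a_gt0 law attS S0 e0.
  by apply: (le_trans le0); rewrite -EFinD lee_fin; nra.
apply: (le_trans le_pay); rewrite -EFinD lee_fin.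
have := raid_arc_le (a_gt0 j) (a_le j) a0_lt u0 uv va.
rewrite -[clipped _ v]/(trap_cdf a j v) -[clipped _ u]/(trap_cdf a j u).
have : 0 <= trap_cdf a j v - trap_cdf a j u.
  by rewrite subr_ge0 (le_trap_cdf a_gt0).
by move: (_ - trap_cdf a j u) => x; nra.
Qed.

(** Merging the two shorter arcs leaves two pieces, of lengths [a i0] and [1 - a i0]. This pair
    already reaches the value, so every maximizing set does. *)
Lemma partition_W_pair : partition_W a [set i1; i2]%SET = a i0 * (1 - a i0).
Proof.
have [_ _ _ sum_a a0_lt] := arcs; have a00 := a_gt0 i0.
have TE : (i0 \in [set i1; i2]%SET = false) * (i1 \in [set i1; i2]%SET) *
  (i2 \in [set i1; i2]%SET) by rewrite !inE.
rewrite /partition_W /partition_D cards2 /= /=.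
rewrite [in X in _ / (_ + X^-1)]big_mkcond [in X in _ / (X + _)]big_mkcond.
rewrite /= !sum_ord3 !TE /= !addr0 !add0r.
have -> : a i1 + a i2 = 1 - a i0 by lra.
have -> : (a i0)^-1 + (1 - a i0)^-1 = (a i0 * (1 - a i0))^-1.
  by field; rewrite !lt0r_neq0 //; lra.
by rewrite invrK -[(3 - 2)%N]/1%N mul1r.
Qed.

Lemma partition_W_ge (S : {set 'I_3}) : partition_choice a S ->
  a i0 * (1 - a i0) <= partition_W a S.
Proof.
move=> [_ /(_ [set i1; i2]%SET)]; rewrite partition_W_pair; apply.
by apply/set0Pn; exists i1; rewrite !inE.
Qed.

Lemma partition_law_guarantees (S : {set 'I_3})
    (s : attacker_strategy (star a) (star_length a)) :
  S != finset.set0 -> a i0 * (1 - a i0) <= partition_W a S ->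
  partition_law S s -> attacker_guarantees s (a i0 * (1 - a i0)).
Proof.
move=> S0 SW law q Qq; apply: le_trans (partition_payoff a_gt0 S0 law Qq).
by rewrite lee_fin.
Qed.

(** Both sides guarantee the value exactly, so the same two strategies serve for every [e]. *)
Lemma star3_value : has_value (star a) (star_length a) (a i0 * (1 - a i0)).
Proof.
have P0 : [set i1; i2]%SET != finset.set0 :> {set 'I_3}.
  by apply/set0Pn; exists i1; rewrite !inE.
move=> e e0; split.
  have [s law] := partition_law_exists a_gt0 P0; exists s => q Qq.
  apply: le_trans (partition_law_guarantees P0 _ law Qq).
    by rewrite lee_fin gerBl ltW.
  by rewrite partition_W_pair.
have [s law] := trap_law_exists3; exists s => S attS.
apply: le_trans (trap_law_guarantees law attS) _.
by rewrite lee_fin lerDl ltW.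
Qed.
End ThreeArcs.

Local Close Scope classical_set_scope.

Theorem theorem15 (R : realType) (a1 a2 a3 : R)
    (h12 : a2 <= a1) (h23 : a3 <= a2) (h3 : 0 < a3)
    (hsum : a1 + a2 + a3 = 1) (h1 : a1 < 2^-1) :
  let a : 'I_3 -> R := tnth [tuple a1; a2; a3] in
  let Q := star a in
  let len := star_length a in
  has_value Q len (a1 * (1 - a1)) /\
  (forall S : {set 'I_3}, partition_choice a S ->
     (exists s : attacker_strategy Q len, partition_law S s) /\
     (forall s : attacker_strategy Q len,
        partition_law S s -> attacker_optimal s)) /\
  ((exists s : defender_strategy Q len, trap_law s) /\
   (forall s : defender_strategy Q len, trap_law s -> defender_optimal s)).
Proof.
move=> a Q len.
(* [tnth] computes on the literal indices, so these are the hypotheses up to conversion. *)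
have arcs : [/\ a i1 <= a i0, a i2 <= a i1, 0 < a i2,
  a i0 + a i1 + a i2 = 1 & a i0 < 2^-1] by [].
have a_gt0 j : 0 < a j.
  by have [? ? ? ? ?] := arcs; elim/ord3_ind: j => //; lra.
have value : has_value Q len (a1 * (1 - a1)) := star3_value arcs.
split=> //; split.
  move=> S choice; split; first exact: partition_law_exists choice.1.
  move=> s law; exists (a1 * (1 - a1)) => //.
  exact: (partition_law_guarantees arcs choice.1
    (partition_W_ge arcs choice) law).
split; first exact: trap_law_exists3.
move=> s law; exists (a1 * (1 - a1)) => //.
exact: (trap_law_guarantees arcs law).
Qed.
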